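(* If $N^{(m)}(U)$ and $J^{(m)}(U)$ are respectively defined as the $m$-order nonlinear polynomial function vector and its corresponding Jacobian matrix, then $$N^{(m)}(U)=\frac{1}{m}\,J^{(m)}(U)\,U$$ is always satisfied.
   Context: $U=(U_1,\dots,U_n)$ is the vector of unknown variables. The term ''nonlinear polynomial function vector'' indicates systems in which all unknown variables are included only in polynomial functions; the order $m$ may be an integer or fractional. The Jacobian matrix is $J^{(m)}(U)=\left(\partial N^{(m)}_i/\partial U_j\right)_{i,j}$. Instances of $m$-order nonlinear polynomial function vectors include the following. (i) The weighted-residual vector of order $m=1+s$ with components $\int_\Omega \big(\sum_k U_k\,p(\phi_k)\big)\big(\sum_k U_k\,r(\phi_k)\big)^s W_i\,d\Omega$, where $p,r$ are linear differential operators, $s$ is any real number, $\phi_k$ are basis functions and $W_i$ are weighting functions on a domain $\Omega$. (ii) $(A_pU)\circ(A_rU)^{\circ s}$ of order $m=1+s$ and $AU^{\circ m}$ of order $m$, where $A_p,A_r,A$ are constant coefficient matrices, $\circ$ is the entrywise (Hadamard) product and $^{\circ s}$ the entrywise power. (iii) The quadratic ($m=2$) term $XAX$, with $X$ an unknown matrix (its rows stacked into a vector) and $A$ a constant matrix. In a mixed system, the parts of different orders are separate vectors, e.g. a quadratic $N^{(2)}$ and a cubic $N^{(3)}$. *)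

(* Defs.v *)
From HB Require Import structures.
From mathcomp Require Import all_boot all_order all_algebra.
From mathcomp Require Import all_classical all_reals all_analysis.

Set Implicit Arguments.
Unset Strict Implicit.
Unset Printing Implicit Defensive.

Import Order.TTheory GRing.Theory Num.Theory.
Import numFieldNormedType.Exports.

Local Open Scope classical_set_scope.
Local Open Scope ring_scope.

(** Real power with an arbitrary real exponent: the algebraic power of any base
    when [s] is an integer, the power of a nonnegative base otherwise.  For a
    non-integer exponent the value at a negative base is [0] by convention. *)
Definition rpow {R : realType} (a s : R) : R :=
  if s \is a Num.int then a ^ Num.floor s
  else if 0 <= a then a `^ s else 0.

(** The points at which [a |-> rpow a s] is defined and differentiable: every
    base for a natural exponent, the nonzero ones for a negative integer, the
    positive ones for a non-integer [s].  The endpoint [0] of the domain is also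
    admitted when [1 < s], the derivative there being [0]. *)
Definition rpow_regular {R : realType} (a s : R) : bool :=
  [|| s \is a Num.nat,
      (s \is a Num.int) && (a != 0),
      0 < a
    | (0 <= a) && (1 < s)].

(** Polynomial expressions, possibly of fractional order, in the unknowns
    [U : 'cV[R]_n]: the unknowns enter only through real powers of linear forms.
    [Int mu D e] is the weighted-residual integral over [x] in [D] of the
    expression [e x], whose coefficients depend on [x]. *)
Inductive polyexpr (R : realType) (n : nat)
    (d : measure_display) (T : measurableType d) : Type :=
| Const of R
| Pow of 'rV[R]_n & R
| Add of polyexpr R n T & polyexpr R n T
| Mul of polyexpr R n T & polyexpr R n T
| Int of {measure set T -> \bar R} & set T & (T -> polyexpr R n T).

Definition linform {R : realType} {n : nat} (a : 'rV[R]_n) (U : 'cV[R]_n) : R :=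
  (a *m U) 0 0.

Fixpoint peval {R : realType} {n : nat} {d : measure_display}
    {T : measurableType d} (e : polyexpr R n T) (U : 'cV[R]_n) {struct e} : R :=
  match e with
  | Const c => c
  | Pow a s => rpow (linform a U) s
  | Add e1 e2 => peval e1 U + peval e2 U
  | Mul e1 e2 => peval e1 U * peval e2 U
  | Int mu D f => Rintegral mu D (fun x => peval (f x) U)
  end.

(** The order is a syntactic degree count; homogeneity is not part of it. *)
Fixpoint has_order {R : realType} {n : nat} {d : measure_display}
    {T : measurableType d} (e : polyexpr R n T) (m : R) {struct e} : Prop :=
  match e with
  | Const _ => m = 0
  | Pow _ s => m = s
  | Add e1 e2 => has_order e1 m /\ has_order e2 m
  | Mul e1 e2 =>
      exists m1 m2 : R, [/\ m = m1 + m2, has_order e1 m1 & has_order e2 m2]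
  | Int _ D f => forall x, D x -> has_order (f x) m
  end.

(** The expression is defined around [U] and its Jacobian makes sense there.
    This holds at every [U] for an integral-free expression with natural
    exponents.  An integral is required to converge near [U] and to depend
    differentiably on the unknowns at [U]. *)
Fixpoint regular_at {R : realType} {n : nat} {d : measure_display}
    {T : measurableType d} (e : polyexpr R n T) (U : 'cV[R]_n) {struct e}
    : Prop :=
  match e with
  | Const _ => True
  | Pow a s => rpow_regular (linform a U) s
  | Add e1 e2 => regular_at e1 U /\ regular_at e2 U
  | Mul e1 e2 => regular_at e1 U /\ regular_at e2 U
  | Int mu D f =>
      [/\ measurable D,
          \forall V \near U, mu.-integrable D (fun x => (peval (f x) V)%:E)
        & differentiable
            (fun V : 'cV[R]_n => Rintegral mu D (fun x => peval (f x) V)) U]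
  end.

Definition polyvec {R : realType} {n p : nat} {d : measure_display}
    {T : measurableType d} (e : 'I_p -> polyexpr R n T) (U : 'cV[R]_n)
    : 'cV[R]_p :=
  \col_i peval (e i) U.

Definition unit_vec {R : realType} {n : nat} (j : 'I_n) : 'cV[R]_n :=
  delta_mx j 0.

(** The matrix of partial derivatives [dN_i / dU_j].  The library's ['J] acts on
    row vectors and is the transposed matrix of the Frechet differential. *)
Definition jacobian_mx {R : realType} {n p : nat} (N : 'cV[R]_n -> 'cV[R]_p)
    (U : 'cV[R]_n) : 'M[R]_(p, n) :=
  \matrix_(i, j) 'D_(unit_vec j) (fun V : 'cV[R]_n => N V i 0) U.

(* Main.v *)
(** An expression of order [m] is positively homogeneous of degree [m]:
    differentiating [N (t U) = t^m N U] at [t = 1] gives Euler's identity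
    [dN_U U = m N U], and [J U] is the differential at [U] applied to [U]. *)
Require Import Defs.
From HB Require Import structures.
From mathcomp Require Import all_boot all_order all_algebra.
From mathcomp Require Import all_classical all_reals all_analysis.

Import Order.TTheory GRing.Theory Num.Theory.
Import numFieldNormedType.Exports.
Import HBNNSimple.

Local Open Scope classical_set_scope.
Local Open Scope ring_scope.

(** No measurability or integrability of [f] is assumed: regularity of an
    expression constrains only the outermost of nested integrals, so the inner
    integrands are arbitrary. *)
Lemma integral_pZl (R : realType) (d : measure_display) (T : measurableType d)
    (mu : {measure set T -> \bar R}) (D : set T) (f : T -> \bar R) (c : R) :
  0 < c ->
  (\int[mu]_(x in D) (c%:E * f x) = c%:E * \int[mu]_(x in D) f x)%E.
Proof.
move=> c0.
(* By definition the integral is the supremum of [lower] for the positive part minus that for the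
   negative part, so it is enough to scale simple functions, by [c] one way and by [c^-1] the
   other. *)
pose lower (g : T -> \bar R) := [set sintegral mu h |
  h in [set h : {nnsfun T >-> R} | forall x, ((h x)%:E <= g x)%E]].
have lowerZ g : lower (fun x => c%:E * g x)%E = [set (c%:E * y)%E | y in lower g].
  apply/seteqP; split => [_ [h hg <-]|_ [_ [h hg <-] <-]].
    exists (c^-1%:E * sintegral mu h)%E.
      have cV0 : 0 <= c^-1 by rewrite invr_ge0 ltW.
      exists (scale_nnsfun h cV0); last exact: sintegralrM.
      by move=> x /=; rewrite EFinM lee_pdivrMl.
    by rewrite muleA -EFinM divff ?gt_eqF// mul1e.
  exists (scale_nnsfun h (ltW c0)); last exact: sintegralrM.
  by move=> x /=; rewrite EFinM lee_pmul2l// lte_fin.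
have int_lower g : (\int[mu]_(x in D) g x =
    ereal_sup (lower ((g \_ D)^\+)) - ereal_sup (lower ((g \_ D)^\-)))%E by [].
rewrite !int_lower erestrict_scale.
rewrite ge0_funeposM ?ltW// ge0_funenegM ?ltW//.
rewrite !lowerZ !ereal_sup_pZl//.
(* Distributivity over a difference of extended reals is checked case by case, [+oo - +oo] being
   [-oo] by convention. *)
case: (ereal_sup (lower (f \_ D)^\+%E)) => [a| |];
  case: (ereal_sup (lower (f \_ D)^\-%E)) => [b| |] /=;
  rewrite -?EFinB -?EFinM ?(gt0_muley,gt0_muleNy,lte_fin)//=.
by rewrite mulrBr.
Qed.

Lemma Rintegral_pZl (R : realType) (d : measure_display) (T : measurableType d)
    (mu : {measure set T -> \bar R}) (D : set T) (f : T -> R) (c : R) :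
  0 < c ->
  Rintegral mu D (fun x => c * f x) = c * Rintegral mu D f.
Proof.
move=> c0; rewrite /Rintegral.
under eq_integral do rewrite EFinM.
(* An infinite integral stays infinite under scaling, and its real value is 0 by convention. *)
rewrite integral_pZl//; case: (\int[mu]_(x in D) _)%E => [r| |] //=.
  by rewrite gt0_muley ?lte_fin//= mulr0.
by rewrite gt0_muleNy ?lte_fin//= mulr0.
Qed.

Lemma rpowM (R : realType) (t a s : R) :
  0 < t -> rpow (t * a) s = t `^ s * rpow a s.
Proof.
move=> t0; rewrite /rpow; case: ifPn => [sint|_].
  by rewrite expfzMl -[in t `^ s](floorK sint) powR_intmul ?ltW.
(* A positive factor keeps the sign of the base, so both sides take the same branch of [rpow]. *)
rewrite pmulr_rge0//; case: ifPn => [a0|_]; last by rewrite mulr0.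
by rewrite powRM// ltW.
Qed.

Lemma linformZ (R : realType) (n : nat) (a : 'rV[R]_n) (t : R) (U : 'cV[R]_n) :
  linform a (t *: U) = t * linform a U.
Proof. by rewrite /linform -scalemxAr mxE. Qed.

Lemma peval_homogeneous (R : realType) (n : nat) (d : measure_display)
    (T : measurableType d) (e : polyexpr R n T) (m t : R) (U : 'cV[R]_n) :
  has_order e m -> 0 < t -> peval e (t *: U) = t `^ m * peval e U.
Proof.
move=> em t0; elim: e m em => [c|a s|e1 IH1 e2 IH2|e1 IH1 e2 IH2|mu D f IH] m /=.
- by move=> ->; rewrite powRr0 mul1r.
- by move=> ->; rewrite linformZ rpowM.
- by move=> [/IH1-> /IH2->]; rewrite mulrDr.
- move=> [m1 [m2 [-> /IH1-> /IH2->]]].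
  by rewrite powRD ?(gt_eqF t0) ?implybT// mulrACA.
- move=> fm; rewrite -Rintegral_pZl ?powR_gt0//.
  by apply: eq_Rintegral => x; rewrite inE => /fm; exact: IH.
Qed.

Lemma derivable_exprz (R : realType) (a : R) (k : int) :
  (0 <= k) || (a != 0) -> derivable (fun x : R => x ^ k) a 1.
Proof.
case: k => [k _|k /= a0]; first exact: exprn_derivable.
apply: derivableV; first by rewrite expf_neq0.
exact: exprn_derivable.
Qed.

Lemma derivable_rpow (R : realType) (a s : R) :
  rpow_regular a s -> derivable (fun x => rpow x s) a 1.
Proof.
have [sint|sNint] := boolP (s \is a Num.int).
  move=> reg; have -> : (fun x => rpow x s) = (fun x => x ^ Num.floor s).
    by apply/funext => x; rewrite /rpow sint.
  apply: derivable_exprz; rewrite -(ler0z R) floorK//.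
  move: reg; rewrite /rpow_regular natrEint sint /=.
  case/or4P => [->//|->|/gt_eqF->|/andP[_ s1]]; rewrite ?orbT//.
  by rewrite (le_trans ler01 (ltW s1)).
rewrite /rpow_regular natrEint (negbTE sNint) /=.
have rpowE x : 0 <= x -> rpow x s = x `^ s.
  by move=> x0; rewrite /rpow (negbTE sNint) x0.
have rpow_lt0 x : x < 0 -> rpow x s = 0.
  by move=> x0; rewrite /rpow (negbTE sNint) leNgt x0.
(* A positive base stays positive nearby, where [rpow] agrees with the real power. *)
have pos : 0 < a -> derivable (fun x => rpow x s) a 1.
  move=> a0; apply: (@near_eq_derivable _ _ _ (fun x => x `^ s)).
    by near=> x; rewrite rpowE// ltW//; near: x; exact: lt_nbhsr.
  by apply: derivable_powR; rewrite in_itv/= a0.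
case/orP => [/pos//|/andP[]]; rewrite le_eqVlt => /orP[/eqP<- s1|/pos//].
have s0 : s != 0 by rewrite gt_eqF// (lt_trans ltr01).
(* At [a = 0] the difference quotient is [h `^ (s - 1)] on the right of [0]
   and vanishes on the left. *)
apply/cvg_ex; exists 0.
apply: (@cvg_at_right_left_dnbhs _ R^o).
  apply: cvg_trans (@powR_cvg0 R (s - 1) _); last by rewrite subr_gt0.
  apply: near_eq_cvg; near=> h.
  have h0 : 0 < h by near: h; exact: nbhs_right_gt.
  rewrite /= [h *: _]mulr1 addr0 (rpowE _ (ltW h0)) (rpowE _ (lexx 0)) powR0// subr0.
  by rewrite powRD ?(gt_eqF h0) ?implybT// powR_inv1 ?ltW// mulrC.
apply: cvg_near_cst; near=> h.
have h0 : h < 0 by near: h; exact: nbhs_left_lt.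
by rewrite /= [h *: _]mulr1 addr0 rpow_lt0// (rpowE _ (lexx 0)) powR0// subr0
  scaler0.
Unshelve. all: by end_near. Qed.

Lemma differentiable_linform (R : realType) (n : nat) (a : 'rV[R]_n)
    (U : 'cV[R]_n) : differentiable (linform a) U.
Proof.
have -> : linform a = \sum_(j < n) (fun V : 'cV[R]_n => a 0 j * V j 0).
  by apply/funext => V; rewrite /linform mxE fct_sumE.
apply: differentiable_sum => j.
by apply: differentiableM; [exact: differentiable_cst|exact: differentiable_coord].
Qed.

Lemma differentiable_peval (R : realType) (n : nat) (d : measure_display)
    (T : measurableType d) (e : polyexpr R n T) (U : 'cV[R]_n) :
  regular_at e U -> differentiable (peval e) U.
Proof.
elim: e => [c|a s|e1 IH1 e2 IH2|e1 IH1 e2 IH2|mu D f _] /=.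
- by move=> _; exact: differentiable_cst.
- move=> reg; apply: (@differentiable_comp _ _ _ _ (linform a) (fun x => rpow x s)).
    exact: differentiable_linform.
  exact/derivable1_diffP/derivable_rpow.
- by move=> [/IH1 d1 /IH2 d2]; exact: differentiableD.
- by move=> [/IH1 d1 /IH2 d2]; exact: differentiableM.
(* Differentiability of an integral in the unknowns is part of [regular_at]. *)
- by case.
Qed.

Lemma euler_homogeneous (R : realType) (V : normedModType R) (f : V -> R)
    (m : R) (u : V) :
  differentiable f u -> (forall t : R, 0 < t -> f (t *: u) = t `^ m * f u) ->
  'd f u u = m * f u.
Proof.
move=> df hom.
have dray : differentiable (fun t : R => t *: u) (1 : R).
  exact: differentiableZl.
have df1 : differentiable f ((1 : R) *: u) by rewrite scale1r.
(* Chain rule along the ray through [u], whose velocity at [t = 1] is [u]. *)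
have <- : 'D_1 (fun t : R => f (t *: u)) (1 : R) = 'd f u u.
  rewrite deriveE; last exact: (differentiable_comp dray df1).
  rewrite (diff_comp dray df1) /= diffZl//.
  by rewrite diff_val /= !scale1r.
(* Homogeneity for [t > 0] covers a neighbourhood of 1, which determines the derivative there. *)
rewrite (near_eq_derive (g := fun t : R => t `^ m * f u)); last first.
  by near=> t; apply: hom; near: t; exact: lt_nbhsr.
have dpow := is_derive1_powR m (@ltr01 R).
by rewrite derive_val !powR1 scaler0 add0r mulr1 [LHS]mulrC.
Unshelve. all: by end_near. Qed.

Lemma jacobian_mx_mulE (R : realType) (n p : nat) (N : 'cV[R]_n -> 'cV[R]_p)
    (U W : 'cV[R]_n) (i : 'I_p) :
  differentiable (fun V : 'cV[R]_n => N V i 0) U ->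
  (jacobian_mx N U *m W) i 0 = 'd (fun V : 'cV[R]_n => N V i 0) U W.
Proof.
(* Expanding [W] in the standard basis turns the differential into a combination of partial
   derivatives. *)
move=> dN; rewrite mxE {2}[W]matrix_sum_delta linear_sum /=.
by apply: eq_bigr => j _; rewrite big_ord1 linearZ /= mxE deriveE// mulrC.
Qed.

Theorem theorem2p2 (R : realType) (n p : nat) (d : measure_display)
    (T : measurableType d) (m : R) (e : 'I_p -> polyexpr R n T)
    (U : 'cV[R]_n) :
  m != 0 ->
  (forall i, has_order (e i) m) ->
  (forall i, regular_at (e i) U) ->
  (forall i j,
     derivable (fun V : 'cV[R]_n => polyvec e V i 0) U (unit_vec j)) /\
  polyvec e U = m^-1 *: (jacobian_mx (polyvec e) U *m U).
Proof.
move=> m0 em reg.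
have peE i : (fun V : 'cV[R]_n => polyvec e V i 0) = peval (e i).
  by apply/funext => V; rewrite mxE.
have de i : differentiable (fun V : 'cV[R]_n => polyvec e V i 0) U.
  by rewrite peE; exact: differentiable_peval.
(* The partial derivatives exist, so the entries of [jacobian_mx] are genuine limits and not default
   values. *)
split=> [i j|]; first exact: diff_derivable.
apply/colP => i; rewrite mxE [RHS]mxE jacobian_mx_mulE// peE.
rewrite (@euler_homogeneous _ _ _ m); first by rewrite mulKf.
  by rewrite -peE.
by move=> t t0; exact: peval_homogeneous.
Qed.
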